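(* Let $u\in C^\infty(\mathbb{R}^2)$ be a coordinate-convex function satisfying $$(u_{11}u_{22})^{1/2}=1\quad\text{on }\mathbb{R}^2.$$ If in addition there is a constant $C>0$ such that $|u(x)|<C(1+|x|^2)$ for all $x\in\mathbb{R}^2$, then $u$ is a quadratic polynomial (a polynomial of degree $2$).
   Context: Subscripts denote partial derivatives: $u_{ij}=\partial_i\partial_j u$. A continuous function on $\mathbb{R}^2$ is called coordinate-convex if it is convex when restricted to lines parallel to the coordinate axes. For a $C^2$ function this means $u_{11}\ge 0$ and $u_{22}\ge 0$. *)

(* Defs.v *)
(* Stdlib reals with Coquelicot. *)
From Stdlib Require Import Reals.
From Coquelicot Require Import Coquelicot.
Open Scope R_scope.

(* [ex_diff_n u n x y] at every point says that all iterated partial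
   derivatives of [u] of order at most [n], taken in any order, exist and are
   jointly continuous. *)
Definition smooth (u : R -> R -> R) : Prop :=
  forall (n : nat) (x y : R), ex_diff_n u n x y.

Definition convex_on_R (f : R -> R) : Prop :=
  forall a b t : R, 0 <= t <= 1 ->
    f (t * a + (1 - t) * b) <= t * f a + (1 - t) * f b.

Definition coordinate_convex (u : R -> R -> R) : Prop :=
  (forall x y : R, continuity_2d_pt u x y) /\
  (forall y : R, convex_on_R (fun x => u x y)) /\
  (forall x : R, convex_on_R (fun y => u x y)).

(* The degree is exactly 2: some coefficient of degree 2 is nonzero. *)
Definition quadratic_polynomial (u : R -> R -> R) : Prop :=
  exists a b c d e f : R,
    (a <> 0 \/ b <> 0 \/ c <> 0) /\
    forall x y : R,
      u x y = a * x ^ 2 + b * (x * y) + c * y ^ 2 + d * x + e * y + f.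

(* [norm] on the product [R * R] is the Euclidean norm. *)
Definition quadratic_growth (u : R -> R -> R) : Prop :=
  exists C : R, 0 < C /\
    forall x y : R, Rabs (u x y) < C * (1 + norm ((x, y) : R * R) ^ 2).

(* Main.v *)
Require Import Defs.
From Stdlib Require Import Reals Lra.
From Coquelicot Require Import Coquelicot.
Open Scope R_scope.

(** Write [al = u_11], [be = u_22], [s = u_12], [a = u_1] and [phi = ln al], so
    that [al * be = 1] and [be = exp (- phi)]. The proof is a Caccioppoli
    argument for [s], made possible by an entropy identity.

    Convexity and quadratic growth bound [u_1] and [u_2] by [K r] on the square
    [S_r] of side [2 r] centred at the origin, for [r >= 1]; hence integrating
    [u_11] along horizontal lines and [u_22] along vertical ones bounds the
    integral of [al + be] over [S_r] by [8 K r^2] ([trace_integral]).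

    The function [s] solves the divergence-form equation
    [(be s_1)_1 + (al s_2)_2 = 0] ([D12_equation]), and the trace of its
    coefficient matrix is [al + be]. To test this equation with [s] times a
    cutoff one needs the stronger bound of the integral of [s^2 (al + be)] by
    [C r^2]. It comes from the fact that [be w_11 - al w_22] is a divergence
    for every [w]: with [w] the product of [a^2] and a squared cutoff, and one
    more integration by parts, the leading term becomes
    [2 al - 2 s^2 al - 4 al phi]. Since [al phi >= -1], and the terms where the
    cutoff is differentiated are controlled by multiples of [al + be] and a
    part of [s^2 al], this bounds the integral of [s^2 al]
    ([entropy_estimate]); exchanging the two coordinates bounds that of
    [s^2 be] ([mixed_estimate]).

    Thus the energies [I(r)], the integrals over [S_r] of
    [be s_1^2 + al s_2^2] against the fourth power of the cutoff, are bounded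
    ([energy_bounded]), and [I(r) <= c l (I(2 r) - I(r)) + b / l] for every
    [l > 0] ([energy_step]). Summation over dyadic radii forces [I(r) = 0]
    ([hole_filling]). So [s] is constant; since [u_112 = s_1], [u_122 = s_2]
    and [al be = 1], all third derivatives of [u] vanish. *)

(** * Functions of two variables *)

Definition cont2 (f : R -> R -> R) : Prop :=
  forall x y : R, continuity_2d_pt f x y.

(** [der1 f f'] and [der2 f f']: the function [f'] is the partial derivative of
    [f] in the first, respectively second, variable. *)
Definition der1 (f f' : R -> R -> R) : Prop :=
  forall x y : R, is_derive (fun t => f t y) x (f' x y).

Definition der2 (f f' : R -> R -> R) : Prop :=
  forall x y : R, is_derive (fun t => f x t) y (f' x y).

Definition swap (f : R -> R -> R) (x y : R) : R := f y x.

Lemma cont2_swap f : cont2 f -> cont2 (swap f).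
Proof.
  intros Hf x y eps; destruct (Hf y x eps) as [d Hd].
  exists d; intros v w Hv Hw; apply Hd; assumption.
Qed.

Lemma cont2_section1 f : cont2 f -> forall x y, continuous (fun t => f t y) x.
Proof.
  intros Hf x y; apply continuity_pt_filterlim, continuity_pt_locally.
  intros eps; destruct (Hf x y eps) as [d Hd]; exists d; intros t Ht.
  apply Hd; [exact Ht|]. rewrite Rminus_diag, Rabs_R0; apply cond_pos.
Qed.

Lemma cont2_section2 f : cont2 f -> forall x y, continuous (fun t => f x t) y.
Proof. intros Hf x y; apply (cont2_section1 (swap f) (cont2_swap f Hf) y x). Qed.

(** * Integrals over squares *)

Lemma ex_RInt_section1 f : cont2 f ->
  forall a b y, ex_RInt (fun t => f t y) a b.
Proof.
  intros Hf a b y; apply @ex_RInt_continuous; intros z _.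
  apply cont2_section1, Hf.
Qed.

Lemma continuous_RInt_param f : cont2 f ->
  forall a b y, a <= b -> continuous (fun y => RInt (fun x => f x y) a b) y.
Proof.
  intros Hf a b y Hab; apply continuity_pt_filterlim, continuity_pt_locally.
  intros eps.
  assert (He : 0 < eps / (2 * (b - a + 1)))
    by (apply Rdiv_lt_0_compat; [apply cond_pos | lra]).
  destruct (uniform_continuity_2d_1d f a b y (fun x _ => Hf x y) (mkposreal _ He))
    as [d Hd]; simpl in Hd.
  exists d; intros t Ht.
  change (Rabs (t - y) < d) in Ht.
  destruct (Rabs_def2 _ _ Ht) as [Ht1 Ht2].
  assert (Hd0 := cond_pos d).
  rewrite <- (RInt_minus (V := R_CompleteNormedModule)) by
    (apply (ex_RInt_section1 f Hf)).
  apply Rle_lt_trans with ((b - a) * (eps / (2 * (b - a + 1)))).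
  - apply abs_RInt_le_const; [exact Hab | |].
    + apply @ex_RInt_minus; apply (ex_RInt_section1 f Hf).
    + intros x Hx; apply Rlt_le, Hd; try lra.
      rewrite Rminus_diag, Rabs_R0; apply cond_pos.
  - assert (H := cond_pos eps).
    replace (pos eps) with ((b - a) * (eps / (2 * (b - a + 1)))
       + (b - a + 2) * (eps / (2 * (b - a + 1)))) at 2 by (field; lra).
    assert (0 < (b - a + 2) * (eps / (2 * (b - a + 1)))); [|lra].
    apply Rmult_lt_0_compat; lra.
Qed.

(** Fubini's theorem for continuous functions on a rectangle: as functions of
    the endpoint [b], both sides have the derivative
    [RInt (fun y => f b y) c d] and vanish at [b = a]. *)
Lemma RInt_Fubini f : cont2 f -> forall a b c d, a <= b -> c <= d ->
  RInt (fun y => RInt (fun x => f x y) a b) c d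
  = RInt (fun x => RInt (fun y => f x y) c d) a b.
Proof.
  intros Hf a b c d Hab Hcd.
  assert (Hin : forall x, continuous (fun x => RInt (fun y => f x y) c d) x)
    by (intros x; apply (continuous_RInt_param (swap f) (cont2_swap f Hf)), Hcd).
  assert (Hd1 : forall z y, is_derive (fun z => RInt (fun x => f x y) a z) z (f z y)).
  { intros z y; apply (is_derive_RInt (fun x => f x y) _ a).
    - apply filter_forall; intros w; apply (RInt_correct (V := R_CompleteNormedModule)),
        (ex_RInt_section1 f Hf).
    - apply cont2_section1, Hf. }
  set (G := fun z => RInt (fun y => RInt (fun x => f x y) a z) c d).
  assert (HG : forall z, a <= z -> z <= b ->
    RInt (fun x => RInt (fun y => f x y) c d) a z = G z - G a).
  2:{ assert (HGa : G a = 0).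
      { unfold G; rewrite (RInt_ext _ (fun _ => 0)).
        - rewrite RInt_const; apply (scal_zero_r (V := R_NormedModule)).
        - intros y _; apply (RInt_point (V := R_CompleteNormedModule)). }
      rewrite (HG b Hab (Rle_refl b)), HGa; symmetry; apply Rminus_0_r. }
  intros z Haz Hzb; apply is_RInt_unique.
  apply (is_RInt_derive G).
  - intros x Hx; unfold G.
    evar_last.
    + apply (is_derive_RInt_param (fun z y => RInt (fun x => f x y) a z) c d x).
      * apply filter_forall; intros w t _; eexists; apply Hd1.
      * intros t _.
        apply (continuity_2d_pt_ext f); [|apply Hf].
        intros p q; symmetry; apply is_derive_unique, Hd1.
      * apply filter_forall; intros w.
        apply @ex_RInt_continuous; intros t _.
        destruct (Rle_dec a w) as [Haw|Haw].
        -- apply (continuous_RInt_param f Hf a w t Haw).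
        -- apply (continuous_ext (fun y => opp (RInt (fun x => f x y) w a))).
           ++ intros y; apply (opp_RInt_swap (V := R_CompleteNormedModule)).
              apply (ex_RInt_section1 f Hf).
           ++ apply @continuous_opp, (continuous_RInt_param f Hf w a t); lra.
    + apply RInt_ext; intros y _; apply is_derive_unique, Hd1.
  - intros x _; apply Hin.
Qed.

(** Integral of [f] over the square [[-r, r] x [-r, r]], as an iterated
    integral: the inner variable is the first one. *)
Definition square_int (r : R) (f : R -> R -> R) : R :=
  RInt (fun y => RInt (fun x => f x y) (- r) r) (- r) r.

Lemma ex_RInt_square f : cont2 f -> forall a b c d, a <= b ->
  ex_RInt (fun y => RInt (fun x => f x y) a b) c d.
Proof.
  intros Hf a b c d Hab; apply @ex_RInt_continuous; intros z _.
  apply continuous_RInt_param; assumption.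
Qed.

Lemma square_int_swap r f : 0 <= r -> cont2 f -> square_int r (swap f) = square_int r f.
Proof.
  intros Hr Hf; unfold square_int; symmetry; apply RInt_Fubini; auto; lra.
Qed.

Lemma square_int_ext r f g : (forall x y, f x y = g x y) -> square_int r f = square_int r g.
Proof.
  intros H; apply RInt_ext; intros y _; apply RInt_ext; intros x _; apply H.
Qed.

Lemma square_int_plus r f g : 0 <= r -> cont2 f -> cont2 g ->
  square_int r (fun x y => f x y + g x y) = square_int r f + square_int r g.
Proof.
  intros Hr Hf Hg; unfold square_int.
  rewrite <- (RInt_plus (V := R_CompleteNormedModule)) by (apply ex_RInt_square; auto; lra).
  apply RInt_ext; intros y _.
  apply (RInt_plus (V := R_CompleteNormedModule)); apply ex_RInt_section1; assumption.
Qed.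

Lemma square_int_scal r f c : 0 <= r -> cont2 f ->
  square_int r (fun x y => c * f x y) = c * square_int r f.
Proof.
  intros Hr Hf; unfold square_int.
  rewrite <- (RInt_scal (V := R_CompleteNormedModule) _ _ _ c)
    by (apply ex_RInt_square; auto; lra).
  apply RInt_ext; intros y _.
  apply (RInt_scal (V := R_CompleteNormedModule)); apply ex_RInt_section1; assumption.
Qed.

Lemma square_int_le r f g : 0 <= r -> cont2 f -> cont2 g ->
  (forall x y, - r <= x <= r -> - r <= y <= r -> f x y <= g x y) ->
  square_int r f <= square_int r g.
Proof.
  intros Hr Hf Hg H; apply RInt_le; try lra; try (apply ex_RInt_square; auto; lra).
  intros y Hy; apply RInt_le; try lra; try (apply ex_RInt_section1; auto).
  intros x Hx; apply H; lra.
Qed.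

Lemma square_int_nonneg r f : 0 <= r -> cont2 f ->
  (forall x y, - r <= x <= r -> - r <= y <= r -> 0 <= f x y) -> 0 <= square_int r f.
Proof.
  intros Hr Hf H; apply RInt_ge_0; try lra; try (apply ex_RInt_square; auto; lra).
  intros y Hy; apply RInt_ge_0; try lra; try (apply ex_RInt_section1; auto).
  intros x Hx; apply H; lra.
Qed.

Lemma RInt_le_larger (f : R -> R) a b c d : a <= b -> b <= c -> c <= d ->
  (forall p q, ex_RInt f p q) -> (forall x, a <= x <= d -> 0 <= f x) ->
  RInt f b c <= RInt f a d.
Proof.
  intros Hab Hbc Hcd He H.
  rewrite <- (RInt_Chasles f a b d), <- (RInt_Chasles f b c d) by apply He.
  assert (0 <= RInt f a b) by (apply RInt_ge_0; auto; intros; apply H; lra).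
  assert (0 <= RInt f c d) by (apply RInt_ge_0; auto; intros; apply H; lra).
  unfold plus; simpl; lra.
Qed.

Lemma square_int_mono r r' f : 0 <= r -> r <= r' -> cont2 f ->
  (forall x y, - r' <= x <= r' -> - r' <= y <= r' -> 0 <= f x y) ->
  square_int r f <= square_int r' f.
Proof.
  intros Hr Hrr Hf H.
  apply Rle_trans with (RInt (fun y => RInt (fun x => f x y) (- r') r') (- r) r).
  - apply RInt_le; try lra; try (apply ex_RInt_square; auto; lra).
    intros y Hy; apply RInt_le_larger; try lra.
    + intros; apply ex_RInt_section1; auto.
    + intros x Hx; apply H; lra.
  - apply RInt_le_larger; try lra.
    + intros; apply ex_RInt_square; auto; lra.
    + intros y Hy; apply RInt_ge_0; try lra; try (apply ex_RInt_section1; auto).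
      intros x Hx; apply H; lra.
Qed.

Lemma square_int_der1 r f f' : 0 <= r -> der1 f f' -> cont2 f' ->
  square_int r f' = RInt (fun y => f r y - f (- r) y) (- r) r.
Proof.
  intros Hr Hd Hf'; apply RInt_ext; intros y _.
  apply is_RInt_unique, (is_RInt_derive (fun x => f x y)).
  - intros x _; apply Hd.
  - intros x _; apply cont2_section1, Hf'.
Qed.

Lemma square_int_der1_zero r f f' : 0 <= r -> der1 f f' -> cont2 f' ->
  (forall y, f r y = 0 /\ f (- r) y = 0) -> square_int r f' = 0.
Proof.
  intros Hr Hd Hf' H0; rewrite (square_int_der1 r f f' Hr Hd Hf').
  rewrite (RInt_ext _ (fun _ => 0)).
  - rewrite RInt_const; apply (scal_zero_r (V := R_NormedModule)).
  - intros y _; destruct (H0 y) as [-> ->]; apply Rminus_diag.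
Qed.

(** Divergence theorem for a field with vanishing normal component on the
    boundary of the square. *)
Lemma square_int_divergence r P Q p q : 0 <= r -> der1 P p -> der2 Q q ->
  cont2 p -> cont2 q ->
  (forall y, P r y = 0 /\ P (- r) y = 0) ->
  (forall x, Q x r = 0 /\ Q x (- r) = 0) ->
  square_int r (fun x y => p x y + q x y) = 0.
Proof.
  intros Hr HP HQ Hp Hq HP0 HQ0.
  rewrite (square_int_plus r p q Hr Hp Hq), (square_int_der1_zero r P p Hr HP Hp HP0).
  rewrite <- (square_int_swap r q Hr Hq).
  rewrite (square_int_der1_zero r (swap Q) (swap q)); auto using cont2_swap.
  - ring.
  - intros x y; apply HQ.
Qed.

Lemma RInt_zero_eq (f : R -> R) a b : a < b ->
  (forall x, continuous f x) -> (forall x, a <= x <= b -> 0 <= f x) ->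
  RInt f a b = 0 -> forall x, a < x < b -> f x = 0.
Proof.
  intros Hab Hc Hp H0 x Hx.
  assert (He : forall p q, ex_RInt f p q)
    by (intros p q; apply @ex_RInt_continuous; intros; apply Hc).
  destruct (Rle_lt_or_eq_dec 0 (f x) (Hp x ltac:(lra))) as [Hlt|]; [|auto].
  exfalso.
  assert (Hc' := proj1 (continuity_pt_locally f x)
                   (proj2 (continuity_pt_filterlim f x) (Hc x))
                   (mkposreal _ Hlt)).
  destruct Hc' as [d Hd]; simpl in Hd.
  (* On [[x, x + d / 2]] the function stays positive. *)
  set (c := Rmin b (x + d / 2)).
  assert (Hd0 := cond_pos d).
  assert (Hxc : x < c) by (apply Rmin_glb_lt; lra).
  assert (Hcb : c <= b) by apply Rmin_l.
  assert (Hcd : c <= x + d / 2) by apply Rmin_r.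
  assert (0 < RInt f x c).
  { apply RInt_gt_0; auto.
    intros y Hy. assert (Hy' : Rabs (f y - f x) < f x).
    { apply Hd; change (Rabs (y - x) < d); apply Rabs_def1; lra. }
    apply Rabs_def2 in Hy'; lra. }
  assert (RInt f x c <= RInt f a b) by (apply RInt_le_larger; auto; lra).
  lra.
Qed.

Lemma square_int_zero_eq r f : 0 < r -> cont2 f ->
  (forall x y, - r <= x <= r -> - r <= y <= r -> 0 <= f x y) ->
  square_int r f = 0 -> forall x y, - r < x < r -> - r < y < r -> f x y = 0.
Proof.
  intros Hr Hf Hp H0 x y Hx Hy.
  apply (RInt_zero_eq (fun x => f x y) (- r) r); try lra.
  - intros; apply cont2_section1, Hf.
  - intros; apply Hp; lra.
  - apply (RInt_zero_eq (fun y => RInt (fun x => f x y) (- r) r) (- r) r); try lra.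
    + intros; apply continuous_RInt_param; auto; lra.
    + intros z Hz; apply RInt_ge_0; try lra; try (apply ex_RInt_section1; auto).
      intros; apply Hp; lra.
    + exact H0.
Qed.

(** * Partial derivatives of smooth functions *)

(** The first-order partial derivatives as total functions, so that for
    instance [D2 (D1 u)] is [u_12]. *)
Definition D1 (f : R -> R -> R) (x y : R) : R := Derive (fun t => f t y) x.
Definition D2 (f : R -> R -> R) (x y : R) : R := Derive (fun t => f x t) y.

Lemma smooth_D1 f : smooth f -> smooth (D1 f).
Proof. intros Hf n x y; apply (Hf (S n) x y). Qed.

Lemma smooth_D2 f : smooth f -> smooth (D2 f).
Proof. intros Hf n x y; apply (Hf (S n) x y). Qed.

Ltac smooth_tac := repeat first [assumption | apply smooth_D1 | apply smooth_D2].

Lemma smooth_cont2 f : smooth f -> cont2 f.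
Proof. intros Hf x y; apply (Hf O x y). Qed.

Lemma smooth_der1 f : smooth f -> der1 f (D1 f).
Proof. intros Hf x y; apply Derive_correct, (Hf 1%nat x y). Qed.

Lemma smooth_der2 f : smooth f -> der2 f (D2 f).
Proof. intros Hf x y; apply Derive_correct, (Hf 1%nat x y). Qed.

Lemma smooth_swap f : smooth f -> smooth (swap f).
Proof.
  intros Hf n x y; specialize (Hf n y x).
  revert f x y Hf; induction n as [|n IH]; intros f x y [Hc Hd].
  - split; [|exact I].
    intros eps; destruct (Hc eps) as [d Hd']; exists d; intros; apply Hd'; auto.
  - destruct Hd as (He1 & He2 & Hd1 & Hd2); repeat split; auto.
    + intros eps; destruct (Hc eps) as [d Hd']; exists d; intros; apply Hd'; auto.
    + apply (IH (D2 f)), Hd2.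
    + apply (IH (D1 f)), Hd1.
Qed.

Lemma D1_D2 f : smooth f -> forall x y, D1 (D2 f) x y = D2 (D1 f) x y.
Proof.
  intros Hf x y; apply Schwarz.
  - apply locally_2d_forall; intros v w; repeat split.
    + eexists; apply (smooth_der1 f Hf).
    + eexists; apply (smooth_der2 f Hf).
    + eexists; apply (smooth_der1 _ (smooth_D2 f Hf)).
    + eexists; apply (smooth_der2 _ (smooth_D1 f Hf)).
  - apply (smooth_cont2 _ (smooth_D1 _ (smooth_D2 f Hf))).
  - apply (smooth_cont2 _ (smooth_D2 _ (smooth_D1 f Hf))).
Qed.

(** ** Calculus rules *)

Lemma der1_unique f g : der1 f g -> forall x y, D1 f x y = g x y.
Proof. intros H x y; apply is_derive_unique, H. Qed.

Lemma der2_unique f g : der2 f g -> forall x y, D2 f x y = g x y.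
Proof. intros H x y; apply is_derive_unique, H. Qed.

Lemma der1_const c : der1 (fun _ _ => c) (fun _ _ => 0).
Proof. intros x y; apply (is_derive_const (V := R_NormedModule)). Qed.

Lemma der2_const c : der2 (fun _ _ => c) (fun _ _ => 0).
Proof. intros x y; apply (is_derive_const (V := R_NormedModule)). Qed.

Lemma der1_plus f f' g g' : der1 f f' -> der1 g g' ->
  der1 (fun x y => f x y + g x y) (fun x y => f' x y + g' x y).
Proof.
  intros Hf Hg x y.
  apply (is_derive_plus (V := R_NormedModule) (fun t => f t y) (fun t => g t y)); auto.
Qed.

Lemma der2_plus f f' g g' : der2 f f' -> der2 g g' ->
  der2 (fun x y => f x y + g x y) (fun x y => f' x y + g' x y).
Proof.
  intros Hf Hg x y.
  apply (is_derive_plus (V := R_NormedModule) (fun t => f x t) (fun t => g x t)); auto.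
Qed.

Lemma der1_opp f f' : der1 f f' -> der1 (fun x y => - f x y) (fun x y => - f' x y).
Proof. intros Hf x y; apply (is_derive_opp (fun t => f t y)), Hf. Qed.

Lemma der2_opp f f' : der2 f f' -> der2 (fun x y => - f x y) (fun x y => - f' x y).
Proof. intros Hf x y; apply (is_derive_opp (fun t => f x t)), Hf. Qed.

Lemma der1_mult f f' g g' : der1 f f' -> der1 g g' ->
  der1 (fun x y => f x y * g x y) (fun x y => f' x y * g x y + f x y * g' x y).
Proof.
  intros Hf Hg x y.
  apply (is_derive_mult (fun t => f t y) (fun t => g t y)); auto; apply Rmult_comm.
Qed.

Lemma der2_mult f f' g g' : der2 f f' -> der2 g g' ->
  der2 (fun x y => f x y * g x y) (fun x y => f' x y * g x y + f x y * g' x y).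
Proof.
  intros Hf Hg x y.
  apply (is_derive_mult (fun t => f x t) (fun t => g x t)); auto; apply Rmult_comm.
Qed.

Lemma der1_ln f f' : (forall x y, 0 < f x y) -> der1 f f' ->
  der1 (fun x y => ln (f x y)) (fun x y => f' x y * / f x y).
Proof.
  intros Hp Hf x y.
  apply (is_derive_comp ln (fun t => f t y)); [|apply Hf].
  apply is_derive_ln, Hp.
Qed.

Lemma cont2_const c : cont2 (fun _ _ => c).
Proof. intros x y; apply continuity_2d_pt_const. Qed.

Lemma cont2_plus f g : cont2 f -> cont2 g -> cont2 (fun x y => f x y + g x y).
Proof. intros Hf Hg x y; apply continuity_2d_pt_plus; auto. Qed.

Lemma cont2_opp f : cont2 f -> cont2 (fun x y => - f x y).
Proof. intros Hf x y; apply continuity_2d_pt_opp; auto. Qed.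

Lemma cont2_mult f g : cont2 f -> cont2 g -> cont2 (fun x y => f x y * g x y).
Proof. intros Hf Hg x y; apply continuity_2d_pt_mult; auto. Qed.

Lemma cont2_inv f : (forall x y, 0 < f x y) -> cont2 f -> cont2 (fun x y => / f x y).
Proof.
  intros Hp Hf x y; apply continuity_2d_pt_inv; auto.
  specialize (Hp x y); lra.
Qed.

Lemma cont2_ln f : (forall x y, 0 < f x y) -> cont2 f -> cont2 (fun x y => ln (f x y)).
Proof.
  intros Hp Hf x y; apply (continuity_1d_2d_pt_comp ln); [|apply Hf].
  apply derivable_continuous_pt; eexists; apply derivable_pt_lim_ln, Hp.
Qed.

(** * The cutoff *)

(** A polynomial cutoff on the square of side [2 r]: it lies between 0 and 1
    there and vanishes on the boundary, and is only used on the square. The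
    suffixes name its partial derivatives. *)
Definition eta (r x y : R) : R := (1 - (x / r) ^ 2) * (1 - (y / r) ^ 2).
Definition eta1 (r x y : R) : R := - 2 * x / r ^ 2 * (1 - (y / r) ^ 2).
Definition eta2 (r x y : R) : R := - 2 * y / r ^ 2 * (1 - (x / r) ^ 2).
Definition eta11 (r x y : R) : R := - 2 / r ^ 2 * (1 - (y / r) ^ 2).
Definition eta22 (r x y : R) : R := - 2 / r ^ 2 * (1 - (x / r) ^ 2).
Definition eta12 (r x y : R) : R := 4 * x * y / r ^ 4.

Ltac eta_solve r Hr := intros x y; unfold eta, eta1, eta2, eta11, eta22, eta12;
  auto_derive; [exact Logic.I | field; exact Hr].

Lemma eta_der1 r : r <> 0 -> der1 (eta r) (eta1 r).
Proof. intros Hr; eta_solve r Hr. Qed.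
Lemma eta_der2 r : r <> 0 -> der2 (eta r) (eta2 r).
Proof. intros Hr; eta_solve r Hr. Qed.
Lemma eta1_der1 r : r <> 0 -> der1 (eta1 r) (eta11 r).
Proof. intros Hr; eta_solve r Hr. Qed.
Lemma eta1_der2 r : r <> 0 -> der2 (eta1 r) (eta12 r).
Proof. intros Hr; eta_solve r Hr. Qed.
Lemma eta2_der1 r : r <> 0 -> der1 (eta2 r) (eta12 r).
Proof. intros Hr; eta_solve r Hr. Qed.
Lemma eta2_der2 r : r <> 0 -> der2 (eta2 r) (eta22 r).
Proof. intros Hr; eta_solve r Hr. Qed.

Ltac cont2_basic := repeat first
  [ apply cont2_const | apply cont2_plus | apply cont2_opp | apply cont2_mult
  | intros ? ?; apply continuity_2d_pt_id1
  | intros ? ?; apply continuity_2d_pt_id2 ].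

Lemma eta_cont2 r : cont2 (eta r).
Proof. unfold eta, Rdiv, Rminus, pow; cont2_basic. Qed.
Lemma eta1_cont2 r : cont2 (eta1 r).
Proof. unfold eta1, Rdiv, Rminus, pow; cont2_basic. Qed.
Lemma eta2_cont2 r : cont2 (eta2 r).
Proof. unfold eta2, Rdiv, Rminus, pow; cont2_basic. Qed.
Lemma eta11_cont2 r : cont2 (eta11 r).
Proof. unfold eta11, Rdiv, Rminus, pow; cont2_basic. Qed.
Lemma eta22_cont2 r : cont2 (eta22 r).
Proof. unfold eta22, Rdiv, Rminus, pow; cont2_basic. Qed.
Lemma eta12_cont2 r : cont2 (eta12 r).
Proof. unfold eta12, Rdiv, Rminus, pow; cont2_basic. Qed.

Lemma square_scaled r x : 0 < r -> - r <= x <= r -> 0 <= (x / r) ^ 2 <= 1.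
Proof.
  intros Hr Hx; split; [apply pow2_ge_0|].
  assert (H1 : -1 <= x / r) by (apply Rle_div_r; lra).
  assert (H2 : x / r <= 1) by (apply Rle_div_l; lra).
  nra.
Qed.

Lemma eta_bounds r x y : 0 < r -> - r <= x <= r -> - r <= y <= r ->
  0 <= eta r x y <= 1.
Proof.
  intros Hr Hx Hy; unfold eta.
  assert (H1 := square_scaled r x Hr Hx); assert (H2 := square_scaled r y Hr Hy).
  nra.
Qed.

Lemma eta_boundary1 r y : r <> 0 -> eta r r y = 0 /\ eta r (- r) y = 0.
Proof. intros Hr; unfold eta; split; field; exact Hr. Qed.
Lemma eta_boundary2 r x : r <> 0 -> eta r x r = 0 /\ eta r x (- r) = 0.
Proof. intros Hr; unfold eta; split; field; exact Hr. Qed.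

(** The factor [(x / r) ^ 2] on the right, rather than 1, is what makes the
    gradient comparable with the gap between two cutoffs in [eta_double]. *)
Lemma eta1_sq r x y : 0 < r -> - r <= x <= r -> - r <= y <= r ->
  r ^ 2 * eta1 r x y ^ 2 <= 4 * (x / r) ^ 2.
Proof.
  intros Hr Hx Hy; unfold eta1.
  assert (H1 := square_scaled r x Hr Hx); assert (H2 := square_scaled r y Hr Hy).
  replace (r ^ 2 * (- 2 * x / r ^ 2 * (1 - (y / r) ^ 2)) ^ 2) with
    (4 * (x / r) ^ 2 * (1 - (y / r) ^ 2) ^ 2) by (field; lra).
  set (p := (x / r) ^ 2) in *; set (q := (y / r) ^ 2) in *.
  assert ((1 - q) ^ 2 <= 1) by nra. nra.
Qed.

Lemma eta2_sq r x y : 0 < r -> - r <= x <= r -> - r <= y <= r ->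
  r ^ 2 * eta2 r x y ^ 2 <= 4 * (y / r) ^ 2.
Proof.
  intros Hr Hx Hy; exact (eta1_sq r y x Hr Hy Hx).
Qed.

Lemma eta11_bound r x y : 0 < r -> - r <= y <= r ->
  Rabs (r ^ 2 * eta11 r x y) <= 2.
Proof.
  intros Hr Hy; unfold eta11; assert (H2 := square_scaled r y Hr Hy).
  replace (r ^ 2 * (- 2 / r ^ 2 * (1 - (y / r) ^ 2))) with
    (- 2 * (1 - (y / r) ^ 2)) by (field; lra).
  apply Rabs_le; lra.
Qed.

(** Passing from the radius [r] to [2 r] increases the fourth power of the
    cutoff by at least a multiple of [eta^4 |grad eta|^2 r^2]; this
    gap replaces the annulus on which the gradient of a standard cutoff is
    supported. *)
Lemma eta_double r x y : 0 < r -> - r <= x <= r -> - r <= y <= r ->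
  9 * ((x / r) ^ 2 + (y / r) ^ 2) * eta r x y ^ 4 <=
  32 * (eta (2 * r) x y ^ 4 - eta r x y ^ 4).
Proof.
  intros Hr Hx Hy.
  assert (Hb := eta_bounds r x y Hr Hx Hy).
  assert (H1 := square_scaled r x Hr Hx); assert (H2 := square_scaled r y Hr Hy).
  assert (Hd : 9 * ((x / r) ^ 2 + (y / r) ^ 2) <= 32 * (eta (2 * r) x y - eta r x y)).
  { unfold eta.
    replace ((x / (2 * r)) ^ 2) with ((x / r) ^ 2 / 4) by (field; lra).
    replace ((y / (2 * r)) ^ 2) with ((y / r) ^ 2 / 4) by (field; lra).
    nra. }
  set (e := eta r x y) in *; set (d := eta (2 * r) x y) in *.
  assert (Hde : e <= d) by lra.
  assert (H3 : 0 <= e ^ 3) by (apply pow_le; lra).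
  assert (H4 : e ^ 4 <= e ^ 3) by (simpl; simpl in H3; nra).
  assert (H5 : e ^ 3 * (d - e) <= d ^ 4 - e ^ 4).
  { assert (e ^ 3 <= d ^ 3) by (apply pow_incr; lra).
    replace (d ^ 4) with (d ^ 3 * d) by ring.
    replace (e ^ 4) with (e ^ 3 * e) by ring. nra. }
  assert (9 * ((x / r) ^ 2 + (y / r) ^ 2) * e ^ 4
    <= 9 * ((x / r) ^ 2 + (y / r) ^ 2) * e ^ 3)
    by (apply Rmult_le_compat_l; lra).
  nra.
Qed.

(** * Convex functions of one variable *)

(** The graph lies above its tangents; [h] may be negative. *)
Lemma convex_tangent f x l h : convex_on_R f -> is_derive f x l ->
  l * h <= f (x + h) - f x.
Proof.
  intros Hf Hd.
  destruct (Rle_or_lt (l * h) (f (x + h) - f x)) as [H|H]; [exact H|exfalso].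
  assert (Hg : is_derive (fun t => f (x + t * h)) 0 (h * l)).
  { apply (is_derive_comp f (fun t => x + t * h)).
    - rewrite Rmult_0_l, Rplus_0_r; exact Hd.
    - auto_derive; [exact Logic.I | ring]. }
  apply is_derive_Reals in Hg.
  destruct (Hg (l * h - (f (x + h) - f x)) ltac:(lra)) as [d Hd'].
  assert (Hd0 := cond_pos d).
  set (t := Rmin 1 (d / 2)).
  assert (Ht : 0 < t) by (apply Rmin_glb_lt; lra).
  assert (Ht1 : t <= 1) by apply Rmin_l.
  assert (Ht2 : t <= d / 2) by apply Rmin_r.
  specialize (Hd' t ltac:(lra) ltac:(rewrite Rabs_pos_eq; lra)).
  rewrite Rplus_0_l, Rmult_0_l, Rplus_0_r in Hd'.
  apply Rabs_def2 in Hd'.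
  assert (Hc := Hf (x + h) x t ltac:(lra)).
  replace (t * (x + h) + (1 - t) * x) with (x + t * h) in Hc by ring.
  assert (Hq : (f (x + t * h) - f x) / t <= f (x + h) - f x)
    by (apply Rle_div_l; lra).
  lra.
Qed.

Lemma convex_second_derivative f f' x l : convex_on_R f ->
  (forall t, is_derive f t (f' t)) -> is_derive f' x l -> 0 <= l.
Proof.
  intros Hf Hd Hl.
  assert (Hinc : forall s t, s <= t -> f' s <= f' t).
  { intros s t [Hst|Hst]; [|rewrite Hst; lra].
    assert (H1 := convex_tangent f s _ (t - s) Hf (Hd s)).
    assert (H2 := convex_tangent f t _ (s - t) Hf (Hd t)).
    replace (s + (t - s)) with t in H1 by ring.
    replace (t + (s - t)) with s in H2 by ring. nra. }
  destruct (Rle_or_lt 0 l) as [H|H]; [exact H|exfalso].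
  apply is_derive_Reals in Hl.
  destruct (Hl (- l) ltac:(lra)) as [d Hd']; assert (Hd0 := cond_pos d).
  specialize (Hd' (d / 2) ltac:(lra) ltac:(rewrite Rabs_pos_eq; lra)).
  apply Rabs_def2 in Hd'.
  assert (0 <= (f' (x + d / 2) - f' x) / (d / 2)); [|lra].
  apply Rdiv_le_0_compat; [|lra].
  assert (f' x <= f' (x + d / 2)) by (apply Hinc; lra). lra.
Qed.

(** * The equation and its derivatives *)

(** A smooth solution of [u_11 u_22 = 1] with [u_11 > 0]. *)
Definition solution (u : R -> R -> R) : Prop :=
  smooth u /\ (forall x y, 0 < D1 (D1 u) x y) /\
  (forall x y, D1 (D1 u) x y * D2 (D2 u) x y = 1).

(** Both partial derivatives of [u] are at most [K r] in absolute value on the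
    square [[-r, r] x [-r, r]], for every [r >= 1]. *)
Definition linear_gradient (K : R) (u : R -> R -> R) : Prop :=
  forall r x y, 1 <= r -> - r <= x <= r -> - r <= y <= r ->
    Rabs (D1 u x y) <= K * r /\ Rabs (D2 u x y) <= K * r.

Lemma solution_u22_pos u : solution u -> forall x y, 0 < D2 (D2 u) x y.
Proof.
  intros (_ & Hp & He) x y; specialize (Hp x y); specialize (He x y); nra.
Qed.

Lemma solution_swap u : solution u -> solution (swap u).
Proof.
  intros Hu; assert (Hp := solution_u22_pos u Hu); destruct Hu as (Hs & _ & He).
  split; [|split].
  - apply smooth_swap, Hs.
  - intros x y; apply (Hp y x).
  - intros x y; rewrite Rmult_comm; apply (He y x).
Qed.

Lemma linear_gradient_swap K u : linear_gradient K u -> linear_gradient K (swap u).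
Proof.
  intros H r x y Hr Hx Hy; destruct (H r y x Hr Hy Hx); split; assumption.
Qed.

Lemma linear_gradient_nonneg K u : linear_gradient K u -> 0 <= K.
Proof.
  intros HK; destruct (HK 1 0 0 ltac:(lra) ltac:(lra) ltac:(lra)) as [H _].
  pose proof (Rabs_pos (D1 u 0 0)); lra.
Qed.

Lemma D12_swap u : smooth u -> forall x y, D2 (D1 (swap u)) x y = D2 (D1 u) y x.
Proof. intros Hu x y; apply (D1_D2 u Hu y x). Qed.

Lemma D2_u11 u : smooth u -> forall x y, D2 (D1 (D1 u)) x y = D1 (D2 (D1 u)) x y.
Proof. intros Hu x y; symmetry; apply D1_D2, smooth_D1, Hu. Qed.

Lemma D1_u22 u : smooth u -> forall x y, D1 (D2 (D2 u)) x y = D2 (D2 (D1 u)) x y.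
Proof.
  intros Hu x y; rewrite (D1_D2 _ (smooth_D2 u Hu)).
  apply Derive_ext; intros t; apply (D1_D2 u Hu).
Qed.

Lemma inverse_of_product a b : 0 < a -> a * b = 1 -> b = / a.
Proof.
  intros Ha Hab; apply Rmult_eq_reg_l with a; [rewrite Hab; field; lra | lra].
Qed.

Lemma solve_differentiated_product a b a1 t :
  a * b = 1 -> a1 * b + a * t = 0 -> a1 = - a ^ 2 * t.
Proof.
  intros Hab H; transitivity (a * (a1 * b)).
  - transitivity (a1 * (a * b)); [rewrite Hab|]; ring.
  - replace (a1 * b) with (- (a * t)) by lra; ring.
Qed.

(** The equation differentiated in the first variable, with [be_1] written as
    [s_2]; similarly below with [al_2 = s_1]. *)
Lemma D1_equation u : solution u -> forall x y,
  D1 (D1 (D1 u)) x y * D2 (D2 u) x y + D1 (D1 u) x y * D2 (D2 (D1 u)) x y = 0.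
Proof.
  intros (Hs & _ & He) x y; rewrite <- (D1_u22 u Hs).
  assert (H := der1_mult _ _ _ _ (smooth_der1 (D1 (D1 u)) ltac:(smooth_tac))
                 (smooth_der1 (D2 (D2 u)) ltac:(smooth_tac))).
  rewrite <- (der1_unique _ _ H x y).
  rewrite <- (der1_unique _ _ (der1_const 1) x y).
  apply Derive_ext; intros t; apply He.
Qed.

Lemma D2_equation u : solution u -> forall x y,
  D1 (D2 (D1 u)) x y * D2 (D2 u) x y + D1 (D1 u) x y * D2 (D2 (D2 u)) x y = 0.
Proof.
  intros (Hs & _ & He) x y; rewrite <- (D2_u11 u Hs).
  assert (H := der2_mult _ _ _ _ (smooth_der2 (D1 (D1 u)) ltac:(smooth_tac))
                 (smooth_der2 (D2 (D2 u)) ltac:(smooth_tac))).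
  rewrite <- (der2_unique _ _ H x y).
  rewrite <- (der2_unique _ _ (der2_const 1) x y).
  apply Derive_ext; intros t; apply He.
Qed.

(** The mixed derivative [s = u_12] satisfies
    [be s_11 + al s_22 + 2 s_1 s_2 = 0], that is,
    [(be s_1)_1 + (al s_2)_2 = 0], because [be_1 = s_2] and [al_2 = s_1]. *)
Lemma D12_equation u : solution u -> forall x y,
  D2 (D2 u) x y * D1 (D1 (D2 (D1 u))) x y + D1 (D1 u) x y * D2 (D2 (D2 (D1 u))) x y
  + 2 * D1 (D2 (D1 u)) x y * D2 (D2 (D1 u)) x y = 0.
Proof.
  intros Hu x y; assert (Hu' := Hu); destruct Hu' as (Hs & Hp & He).
  assert (E1 := D1_equation u Hu x y); assert (E2 := D2_equation u Hu x y).
  eassert (H : der1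
    (fun x y => D1 (D2 (D1 u)) x y * D2 (D2 u) x y + D1 (D1 u) x y * D2 (D2 (D2 u)) x y) _).
  { apply der1_plus; apply der1_mult; apply smooth_der1; smooth_tac. }
  assert (H0 := der1_unique _ _ H x y); cbv beta in H0.
  assert (H1 : D1 (fun x y => D1 (D2 (D1 u)) x y * D2 (D2 u) x y
      + D1 (D1 u) x y * D2 (D2 (D2 u)) x y) x y = 0).
  { rewrite <- (der1_unique _ _ (der1_const 0) x y).
    apply Derive_ext; intros t; apply (D2_equation u Hu). }
  rewrite H0 in H1; clear H H0.
  rewrite (D1_u22 u Hs) in H1.
  assert (E3 : D1 (D2 (D2 (D2 u))) x y = D2 (D2 (D2 (D1 u))) x y).
  { rewrite (D1_D2 (D2 (D2 u))) by smooth_tac.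
    apply Derive_ext; intros t; apply (D1_u22 u Hs). }
  rewrite E3 in H1.
  specialize (Hp x y); specialize (He x y).
  set (al := D1 (D1 u) x y) in *; set (be := D2 (D2 u) x y) in *.
  set (s1 := D1 (D2 (D1 u)) x y) in *; set (s2 := D2 (D2 (D1 u)) x y) in *.
  set (al1 := D1 (D1 (D1 u)) x y) in *; set (be2 := D2 (D2 (D2 u)) x y) in *.
  assert (al1 * be2 = s1 * s2); [|lra].
  assert (Hb := inverse_of_product al be Hp He).
  assert (Ha1 := solve_differentiated_product al be al1 s2 He E1).
  assert (Hb2 : be2 = - be ^ 2 * s1)
    by (apply (solve_differentiated_product be al); lra).
  rewrite Ha1, Hb2, Hb; field; lra.
Qed.

(** * The entropy estimate *)

Lemma u11_integral u K r : solution u -> linear_gradient K u -> 1 <= r ->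
  square_int r (D1 (D1 u)) <= 4 * K * r ^ 2.
Proof.
  intros (Hs & Hp & He) HK Hr.
  rewrite (square_int_der1 r (D1 u)); [|lra|apply smooth_der1; smooth_tac
    |apply smooth_cont2; smooth_tac].
  replace (4 * K * r ^ 2) with (RInt (fun _ => 2 * K * r) (- r) r)
    by (rewrite RInt_const; unfold scal; simpl; unfold mult; simpl; ring).
  assert (Hc := smooth_cont2 _ (smooth_D1 u Hs)).
  apply RInt_le; [lra| | |].
  - apply @ex_RInt_minus; apply @ex_RInt_continuous; intros;
      apply cont2_section2, Hc.
  - apply ex_RInt_const.
  - intros y Hy.
    destruct (HK r r y Hr ltac:(lra) ltac:(lra)) as [H1 _].
    destruct (HK r (- r) y Hr ltac:(lra) ltac:(lra)) as [H2 _].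
    apply Rabs_le_between in H1, H2. lra.
Qed.

Lemma trace_integral u K r : solution u -> linear_gradient K u -> 1 <= r ->
  square_int r (fun x y => D1 (D1 u) x y + D2 (D2 u) x y) <= 8 * K * r ^ 2.
Proof.
  intros Hu HK Hr; assert (Hs := proj1 Hu).
  rewrite square_int_plus; [|lra|apply smooth_cont2; smooth_tac|apply smooth_cont2; smooth_tac].
  assert (H1 := u11_integral u K r Hu HK Hr).
  assert (H2 := u11_integral (swap u) K r (solution_swap u Hu)
     (linear_gradient_swap K u HK) Hr).
  change (D1 (D1 (swap u))) with (swap (D2 (D2 u))) in H2.
  rewrite square_int_swap in H2; [lra|lra|apply smooth_cont2; smooth_tac].
Qed.

Ltac der1_tac := match goal with
  | |- der1 (fun x y => _ + _) _ => apply der1_plus; der1_tac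
  | |- der1 (fun x y => _ * _) _ => apply der1_mult; der1_tac
  | |- der1 (fun x y => - _) _ => apply der1_opp; der1_tac
  | |- der1 (fun x y => ln _) _ => apply der1_ln; [assumption | der1_tac]
  | |- der1 (fun x y => ?c) _ => apply (der1_const c)
  | |- der1 (fun x y => ?f x y) _ => change (fun x y => f x y) with f; der1_tac
  | |- der1 (eta _) _ => apply eta_der1; assumption
  | |- der1 (eta1 _) _ => apply eta1_der1; assumption
  | |- der1 (eta2 _) _ => apply eta2_der1; assumption
  | |- der1 _ _ => apply smooth_der1; smooth_tac
  end.
Ltac der2_tac := match goal with
  | |- der2 (fun x y => _ + _) _ => apply der2_plus; der2_tac
  | |- der2 (fun x y => _ * _) _ => apply der2_mult; der2_tac
  | |- der2 (fun x y => - _) _ => apply der2_opp; der2_tac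
  | |- der2 (fun x y => ?c) _ => apply (der2_const c)
  | |- der2 (fun x y => ?f x y) _ => change (fun x y => f x y) with f; der2_tac
  | |- der2 (eta _) _ => apply eta_der2; assumption
  | |- der2 (eta1 _) _ => apply eta1_der2; assumption
  | |- der2 (eta2 _) _ => apply eta2_der2; assumption
  | |- der2 _ _ => apply smooth_der2; smooth_tac
  end.
Ltac cont2_tac := match goal with
  | |- cont2 (fun x y => _ + _) => apply cont2_plus; cont2_tac
  | |- cont2 (fun x y => _ * _) => apply cont2_mult; cont2_tac
  | |- cont2 (fun x y => - _) => apply cont2_opp; cont2_tac
  | |- cont2 (fun x y => ln _) => apply cont2_ln; [assumption | cont2_tac]
  | |- cont2 (fun x y => / _) => apply cont2_inv; [assumption | cont2_tac]
  | |- cont2 (fun x y => ?c) => apply (cont2_const c)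
  | |- cont2 (fun x y => ?f x y) => change (fun x y => f x y) with f; cont2_tac
  | |- cont2 (eta _) => apply eta_cont2
  | |- cont2 (eta1 _) => apply eta1_cont2
  | |- cont2 (eta2 _) => apply eta2_cont2
  | |- cont2 (eta11 _) => apply eta11_cont2
  | |- cont2 (eta22 _) => apply eta22_cont2
  | |- cont2 (eta12 _) => apply eta12_cont2
  | |- cont2 ?f => first [assumption | apply smooth_cont2; smooth_tac]
  end.

(** Both bounds follow from [ln t <= t - 1] at [a] and at [b]. *)
Lemma ln_bounds a b : 0 < a -> a * b = 1 ->
  Rabs (ln a) <= a + b /\ -1 <= a * ln a.
Proof.
  intros Ha Hab.
  assert (Hb : 0 < b) by nra.
  assert (Hln : forall t, 0 < t -> ln t <= t - 1).
  { intros t Ht; assert (H := exp_ineq1_le (ln t)); rewrite exp_ln in H by exact Ht; lra. }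
  assert (Hb' := inverse_of_product a b Ha Hab).
  assert (H1 := Hln a Ha); assert (H2 := Hln b Hb).
  assert (H3 : ln b = - ln a) by (rewrite Hb'; apply ln_Rinv; exact Ha).
  split; [apply Rabs_le; lra | nra].
Qed.

(** The entropy inequality at one point, in variables scaled to [r = 1]: [n]
    is the value of the cutoff, [E1], [E2] and [F1], [F2] those of its first
    and pure second derivatives. The parenthesis is the divergence computed in
    [entropy_estimate]. The term with [E2 * A * s] is absorbed by half of
    [2 n^2 s^2 al]; the remaining terms are bounded one by one. *)
Lemma entropy_pointwise_unit K A al be s n E1 E2 F1 F2 phi :
  0 < al -> al * be = 1 -> 0 <= n <= 1 ->
  Rabs A <= K -> E1 ^ 2 <= 4 -> E2 ^ 2 <= 4 -> Rabs F1 <= 2 -> Rabs F2 <= 2 ->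
  Rabs phi <= al + be -> -1 <= al * phi ->
  n ^ 2 * (s ^ 2 * al) +
  ((2 * E1 ^ 2 + 2 * n * F1) * A ^ 2 * be + 8 * (n * (E1 * A))
     - (2 * E2 ^ 2 + 2 * n * F2) * A ^ 2 * al
     - 8 * (n * (E2 * A)) * s * al
     - 8 * (n * (E1 * A)) * phi
     + n ^ 2 * (2 * al - 2 * s ^ 2 * al - 4 * (al * phi)))
  <= 100 * (K + 1) ^ 2 * (al + be).
Proof.
  intros Hal Hab Hn HA HE1 HE2 HF1 HF2 Hphi Hent.
  assert (HK : 0 <= K) by (pose proof (Rabs_pos A); lra).
  assert (Hbe : 0 < be) by nra.
  assert (H1 : 1 <= al + be) by nra.
  apply Rabs_le_between in HF1, HF2.
  assert (HA2 : 0 <= A ^ 2 <= K ^ 2).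
  { split; [apply pow2_ge_0|].
    rewrite <- (pow2_abs A); apply pow_incr; split; [apply Rabs_pos | exact HA]. }
  assert (HEabs : Rabs E1 <= 2) by (apply Rabs_le; split; nra).
  assert (HnEA : Rabs (n * (E1 * A)) <= 2 * K).
  { rewrite !Rabs_mult, (Rabs_pos_eq n) by lra.
    assert (0 <= Rabs E1 * Rabs A) by (apply Rmult_le_pos; apply Rabs_pos).
    assert (Rabs E1 * Rabs A <= 2 * K)
      by (apply Rmult_le_compat; try apply Rabs_pos; assumption).
    nra. }
  assert (T1 : (2 * E1 ^ 2 + 2 * n * F1) * A ^ 2 * be <= 12 * K ^ 2 * be).
  { apply Rmult_le_compat_r; [lra|].
    apply Rle_trans with (12 * A ^ 2); [|lra].
    apply Rmult_le_compat_r; [lra|]. nra. }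
  assert (T2 : n * (E1 * A) <= 2 * K * (al + be)).
  { apply Rabs_le_between in HnEA; nra. }
  assert (T3 : - ((2 * E2 ^ 2 + 2 * n * F2) * A ^ 2 * al) <= 4 * K ^ 2 * al).
  { replace (- ((2 * E2 ^ 2 + 2 * n * F2) * A ^ 2 * al)) with
      ((- (2 * E2 ^ 2 + 2 * n * F2)) * A ^ 2 * al) by ring.
    apply Rmult_le_compat_r; [lra|].
    apply Rle_trans with (4 * A ^ 2); [|lra].
    apply Rmult_le_compat_r; [lra|]. nra. }
  assert (T4 : - 8 * (n * (E2 * A)) * s * al
     <= n ^ 2 * s ^ 2 * al + 64 * K ^ 2 * al).
  { apply Rle_trans with (n ^ 2 * s ^ 2 * al + 16 * (E2 ^ 2 * A ^ 2) * al).
    - assert (0 <= (n * s + 4 * (E2 * A)) ^ 2 * al)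
        by (apply Rmult_le_pos; [apply pow2_ge_0 | lra]).
      nra.
    - assert (E2 ^ 2 * A ^ 2 <= 4 * K ^ 2)
        by (apply Rmult_le_compat; try apply pow2_ge_0; lra).
      nra. }
  assert (T5 : - (n * (E1 * A) * phi) <= 2 * K * (al + be)).
  { apply Rle_trans with (Rabs (n * (E1 * A) * phi)).
    - rewrite <- Rabs_Ropp; apply Rle_abs.
    - rewrite Rabs_mult; apply Rmult_le_compat; try apply Rabs_pos; assumption. }
  assert (T6 : n ^ 2 * (2 * al - 4 * (al * phi)) <= 2 * al + 4 * (al + be)).
  { assert (n ^ 2 <= 1) by nra. assert (0 <= n ^ 2) by apply pow2_ge_0. nra. }
  nra.
Qed.

Lemma entropy_pointwise K r a al be s n e1 e2 e11 e22 phi :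
  1 <= r -> 0 < al -> al * be = 1 -> 0 <= n <= 1 ->
  Rabs a <= K * r -> r ^ 2 * e1 ^ 2 <= 4 -> r ^ 2 * e2 ^ 2 <= 4 ->
  Rabs (r ^ 2 * e11) <= 2 -> Rabs (r ^ 2 * e22) <= 2 ->
  Rabs phi <= al + be -> -1 <= al * phi ->
  n ^ 2 * (s ^ 2 * al) +
  ((2 * e1 ^ 2 + 2 * n * e11) * a ^ 2 * be + 8 * n * e1 * a
     - (2 * e2 ^ 2 + 2 * n * e22) * a ^ 2 * al
     - 8 * n * e2 * a * s * al
     - 8 * n * e1 * a * phi
     + n ^ 2 * (2 * al - 2 * s ^ 2 * al - 4 * (al * phi)))
  <= 100 * (K + 1) ^ 2 * (al + be).
Proof.
  intros Hr Hal Hab Hn Ha H1 H2 H11 H22 Hphi Hent.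
  assert (HA : Rabs (a / r) <= K).
  { unfold Rdiv; rewrite Rabs_mult, Rabs_inv, (Rabs_pos_eq r) by lra.
    apply Rle_div_l; lra. }
  assert (HE : forall e, r ^ 2 * e ^ 2 <= 4 -> (r * e) ^ 2 <= 4)
    by (intros e H; rewrite Rpow_mult_distr; exact H).
  eapply Rle_trans; [|exact (entropy_pointwise_unit K (a / r) al be s n (r * e1)
    (r * e2) _ _ phi Hal Hab Hn HA (HE _ H1) (HE _ H2) H11 H22 Hphi Hent)].
  right; field; lra.
Qed.

(** The weighted bound of [s^2 al] by the integral of [al + be], which is
    quadratic in [r] by [trace_integral]. *)
Lemma entropy_estimate u K r : solution u -> linear_gradient K u -> 1 <= r ->
  square_int r (fun x y => eta r x y ^ 2 * (D2 (D1 u) x y ^ 2 * D1 (D1 u) x y))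
  <= 800 * (K + 1) ^ 3 * r ^ 2.
Proof.
  intros Hu HK Hr; assert (Hu' := Hu); destruct Hu' as (Hs & Hp & He).
  assert (Hr0 : r <> 0) by lra.
  (* With w = eta^2 a^2 one has
     be w_11 - al w_22 = (be w_1 + s w_2)_1 - (al w_2 + s w_1)_2;
     the last term of P integrates 4 eta^2 a phi_1 by parts. *)
  set (P := fun x y =>
    2 * (eta r x y * eta1 r x y) * (D1 u x y * D1 u x y) * D2 (D2 u) x y
    + 2 * (eta r x y * eta r x y) * D1 u x y
    + 2 * (eta r x y * eta2 r x y) * (D1 u x y * D1 u x y) * D2 (D1 u) x y
    + 2 * (eta r x y * eta r x y) * D1 u x y * (D2 (D1 u) x y * D2 (D1 u) x y)
    + - (4 * (eta r x y * eta r x y) * D1 u x y * ln (D1 (D1 u) x y))).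
  set (Q := fun x y =>
    - (2 * (eta r x y * eta2 r x y) * (D1 u x y * D1 u x y) * D1 (D1 u) x y
    + 4 * (eta r x y * eta r x y) * D1 u x y * D2 (D1 u) x y * D1 (D1 u) x y
    + 2 * (eta r x y * eta1 r x y) * (D1 u x y * D1 u x y) * D2 (D1 u) x y)).
  eassert (HP : der1 P _) by (unfold P; der1_tac).
  eassert (HQ : der2 Q _) by (unfold Q; der2_tac).
  match type of HP with der1 _ ?p => set (p0 := p) in HP end.
  match type of HQ with der2 _ ?q => set (q0 := q) in HQ end.
  assert (Hp0 : cont2 p0) by (unfold p0; cont2_tac).
  assert (Hq0 : cont2 q0) by (unfold q0; cont2_tac).
  assert (Hdiv : square_int r (fun x y => p0 x y + q0 x y) = 0).
  { apply (square_int_divergence r P Q); auto; try lra.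
    - intros y; destruct (eta_boundary1 r y Hr0) as [E1 E2].
      unfold P; rewrite E1, E2; split; ring.
    - intros x; destruct (eta_boundary2 r x Hr0) as [E1 E2].
      unfold Q; rewrite E1, E2; split; ring. }
  assert (Htr := trace_integral u K r Hu HK Hr).
  assert (Hle : square_int r (fun x y => eta r x y ^ 2 * (D2 (D1 u) x y ^ 2 * D1 (D1 u) x y)
      + (p0 x y + q0 x y))
    <= square_int r (fun x y => 100 * (K + 1) ^ 2 * (D1 (D1 u) x y + D2 (D2 u) x y))).
  { apply square_int_le; try lra.
    - unfold pow; cont2_tac; assumption.
    - unfold pow; cont2_tac.
    - intros x y Hx Hy.
      assert (E1 := D1_equation u Hu x y).
      assert (T1 := D2_u11 u Hs x y); assert (T2 := D1_u22 u Hs x y).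
      destruct (HK r x y Hr Hx Hy) as [Ha _].
      destruct (ln_bounds _ _ (Hp x y) (He x y)) as [Hphi Hent].
      assert (HE1 : r ^ 2 * eta1 r x y ^ 2 <= 4).
      { assert (H := eta1_sq r x y ltac:(lra) Hx Hy).
        assert (H' := square_scaled r x ltac:(lra) Hx); lra. }
      assert (HE2 : r ^ 2 * eta2 r x y ^ 2 <= 4).
      { assert (H := eta2_sq r x y ltac:(lra) Hx Hy).
        assert (H' := square_scaled r y ltac:(lra) Hy); lra. }
      assert (HF1 := eta11_bound r x y ltac:(lra) Hy).
      assert (HF2 : Rabs (r ^ 2 * eta22 r x y) <= 2)
        by exact (eta11_bound r y x ltac:(lra) Hx).
      eapply Rle_trans; [|exact (entropy_pointwise K r _ _ _ (D2 (D1 u) x y) _ _ _ _ _ _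
        Hr (Hp x y) (He x y) (eta_bounds r x y ltac:(lra) Hx Hy) Ha HE1 HE2 HF1 HF2
        Hphi Hent)].
      right; unfold p0, q0; rewrite T1, T2.
      generalize (Hp x y) (He x y) E1; clear.
      generalize (ln (D1 (D1 u) x y)) (D1 (D1 (D1 u)) x y) (D1 (D1 u) x y)
        (D2 (D2 (D1 u)) x y) (D1 (D2 (D1 u)) x y) (D2 (D2 u) x y)
        (D2 (D1 u) x y) (D1 u x y).
      generalize (eta r x y) (eta1 r x y) (eta2 r x y) (eta11 r x y)
        (eta22 r x y) (eta12 r x y).
      intros n e1 e2 e11 e22 e12 phi al1 al s2 s1 be s a Hal Hab HE.
      assert (Hbe := inverse_of_product al be Hal Hab).
      assert (Hal1 := solve_differentiated_product al be al1 s2 Hab HE).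
      rewrite Hal1, Hbe; field; lra. }
  rewrite square_int_plus, Hdiv, square_int_scal in Hle; try lra.
  - assert (HK0 := linear_gradient_nonneg K u HK).
    apply Rle_trans with (100 * (K + 1) ^ 2 * (8 * K * r ^ 2)).
    + rewrite Rplus_0_r in Hle; apply (Rle_trans _ _ _ Hle).
      apply Rmult_le_compat_l; [|exact Htr].
      assert (0 <= (K + 1) ^ 2) by apply pow2_ge_0; lra.
    + assert (0 <= (K + 1) ^ 2 * r ^ 2)
        by (apply Rmult_le_pos; apply pow2_ge_0).
      nra.
  - cont2_tac.
  - unfold pow; cont2_tac.
  - apply cont2_plus; assumption.
Qed.

Lemma mixed_estimate u K r : solution u -> linear_gradient K u -> 1 <= r ->
  square_int r (fun x y => eta r x y ^ 2 * (D2 (D1 u) x y ^ 2 *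
    (D1 (D1 u) x y + D2 (D2 u) x y))) <= 1600 * (K + 1) ^ 3 * r ^ 2.
Proof.
  intros Hu HK Hr; assert (Hs := proj1 Hu).
  assert (H1 := entropy_estimate u K r Hu HK Hr).
  assert (H2 := entropy_estimate (swap u) K r (solution_swap u Hu)
     (linear_gradient_swap K u HK) Hr).
  set (f := fun x y => eta r x y ^ 2 * (D2 (D1 u) x y ^ 2 * D1 (D1 u) x y)) in *.
  set (g := fun x y => eta r x y ^ 2 * (D2 (D1 u) x y ^ 2 * D2 (D2 u) x y)).
  assert (Hf : cont2 f) by (unfold f, pow; cont2_tac).
  assert (Hg : cont2 g) by (unfold g, pow; cont2_tac).
  rewrite (square_int_ext r _ (swap g)) in H2.
  2:{ intros x y; rewrite (D12_swap u Hs); unfold swap, g.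
      unfold eta at 1; rewrite Rmult_comm with (r1 := 1 - (x / r) ^ 2).
      reflexivity. }
  rewrite square_int_swap in H2; [|lra|exact Hg].
  rewrite (square_int_ext r _ (fun x y => f x y + g x y)) by (intros; unfold f, g; ring).
  rewrite square_int_plus; auto; lra.
Qed.

(** * Energy of the mixed derivative *)

(** Energy density [be s_1^2 + al s_2^2] of [s = u_12]. *)
Definition dirichlet (u : R -> R -> R) (x y : R) : R :=
  D2 (D2 u) x y * D1 (D2 (D1 u)) x y ^ 2 + D1 (D1 u) x y * D2 (D2 (D1 u)) x y ^ 2.

(** Weighted energy of [s] on the square of side [2 r]. The fourth power of the
    cutoff leaves a factor [eta^2] in the error term of
    [caccioppoli], as needed to apply [mixed_estimate] on the same square. *)
Definition energy (u : R -> R -> R) (r : R) : R :=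
  square_int r (fun x y => eta r x y ^ 4 * dirichlet u x y).

Lemma dirichlet_cont2 u : smooth u -> cont2 (dirichlet u).
Proof. intros Hs; unfold dirichlet, pow; cont2_tac. Qed.

Lemma eta_pow_cont2 r n : cont2 (fun x y => eta r x y ^ n).
Proof.
  induction n as [|n IH]; simpl; [apply cont2_const|].
  apply cont2_mult; [apply eta_cont2 | exact IH].
Qed.

Lemma dirichlet_nonneg u x y : solution u -> 0 <= dirichlet u x y.
Proof.
  intros Hu; assert (H2 := solution_u22_pos u Hu x y).
  destruct Hu as (_ & Hp & _); specialize (Hp x y); unfold dirichlet.
  apply Rplus_le_le_0_compat; apply Rmult_le_pos; try apply pow2_ge_0; lra.
Qed.

Lemma energy_cont2 u r : smooth u -> cont2 (fun x y => eta r x y ^ 4 * dirichlet u x y).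
Proof. intros Hs; apply cont2_mult; [apply eta_pow_cont2 | apply dirichlet_cont2, Hs]. Qed.

(** The right-hand side is [w] times [l] times the square of
    [n^2 e t + (2 / l) n s]. *)
Lemma weighted_young l n s e t w : 0 < l -> 0 <= w ->
  0 <= l * (n ^ 4 * (e ^ 2 * (w * t ^ 2))) + 4 / l * (n ^ 2 * (s ^ 2 * w))
       + 4 * n ^ 3 * s * e * w * t.
Proof.
  intros Hl Hw.
  replace (l * (n ^ 4 * (e ^ 2 * (w * t ^ 2))) + 4 / l * (n ^ 2 * (s ^ 2 * w))
       + 4 * n ^ 3 * s * e * w * t)
    with (l * w * (n ^ 2 * e * t + 2 / l * (n * s)) ^ 2) by (field; lra).
  apply Rmult_le_pos; [|apply pow2_ge_0]. apply Rmult_le_pos; lra.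
Qed.

(** The equation for [s] tested with [eta^4 s]; the parameter [l] comes from
    Young's inequality. *)
Lemma caccioppoli u K r l : solution u -> linear_gradient K u -> 1 <= r -> 0 < l ->
  energy u r <=
  l * square_int r (fun x y => eta r x y ^ 4 *
      (r ^ 2 * eta1 r x y ^ 2 * (D2 (D2 u) x y * D1 (D2 (D1 u)) x y ^ 2) +
       r ^ 2 * eta2 r x y ^ 2 * (D1 (D1 u) x y * D2 (D2 (D1 u)) x y ^ 2)))
  + 6400 * (K + 1) ^ 3 / l.
Proof.
  intros Hu HK Hr Hl; assert (Hu' := Hu); destruct Hu' as (Hs & Hp & He).
  assert (Hp2 := solution_u22_pos u Hu).
  assert (Hr0 : r <> 0) by lra.
  set (W := fun x y => eta r x y ^ 4 *
      (r ^ 2 * eta1 r x y ^ 2 * (D2 (D2 u) x y * D1 (D2 (D1 u)) x y ^ 2) +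
       r ^ 2 * eta2 r x y ^ 2 * (D1 (D1 u) x y * D2 (D2 (D1 u)) x y ^ 2))).
  set (V := fun x y => eta r x y ^ 2 * (D2 (D1 u) x y ^ 2 *
    (D1 (D1 u) x y + D2 (D2 u) x y))).
  set (P := fun x y => eta r x y * eta r x y * (eta r x y * eta r x y) *
     (D2 (D1 u) x y * D2 (D2 u) x y * D1 (D2 (D1 u)) x y)).
  set (Q := fun x y => eta r x y * eta r x y * (eta r x y * eta r x y) *
     (D2 (D1 u) x y * D1 (D1 u) x y * D2 (D2 (D1 u)) x y)).
  eassert (HP : der1 P _) by (unfold P; der1_tac).
  eassert (HQ : der2 Q _) by (unfold Q; der2_tac).
  match type of HP with der1 _ ?p => set (p0 := p) in HP end.
  match type of HQ with der2 _ ?q => set (q0 := q) in HQ end.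
  assert (Hp0 : cont2 p0) by (unfold p0; cont2_tac).
  assert (Hq0 : cont2 q0) by (unfold q0; cont2_tac).
  assert (Hdiv : square_int r (fun x y => p0 x y + q0 x y) = 0).
  { apply (square_int_divergence r P Q); auto; try lra.
    - intros y; destruct (eta_boundary1 r y Hr0) as [E1 E2].
      unfold P; rewrite E1, E2; split; ring.
    - intros x; destruct (eta_boundary2 r x Hr0) as [E1 E2].
      unfold Q; rewrite E1, E2; split; ring. }
  assert (HV := mixed_estimate u K r Hu HK Hr); fold V in HV.
  assert (HVc : cont2 V) by (unfold V, pow; cont2_tac).
  assert (HWc : cont2 W) by (unfold W, pow; cont2_tac).
  assert (Hc1 : cont2 (fun x y => l * W x y))
    by (apply cont2_mult; [apply cont2_const | exact HWc]).
  assert (Hc2 : cont2 (fun x y => 4 / (l * r ^ 2) * V x y))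
    by (apply cont2_mult; [apply cont2_const | exact HVc]).
  assert (Hpq : cont2 (fun x y => p0 x y + q0 x y)) by (apply cont2_plus; assumption).
  assert (Hle : energy u r <= square_int r (fun x y =>
      (l * W x y + 4 / (l * r ^ 2) * V x y) + (p0 x y + q0 x y))).
  { apply square_int_le; [lra| | |].
    - apply energy_cont2; auto.
    - apply cont2_plus; [apply cont2_plus|]; assumption.
    - intros x y Hx Hy.
      assert (T1 := D2_u11 u Hs x y); assert (T2 := D1_u22 u Hs x y).
      assert (HD := D12_equation u Hu x y).
      assert (Hlr : 0 < l * r ^ 2) by (apply Rmult_lt_0_compat; [lra | apply pow_lt; lra]).
      assert (Y1 := weighted_young (l * r ^ 2) (eta r x y) (D2 (D1 u) x y) (eta1 r x y)
        (D1 (D2 (D1 u)) x y) (D2 (D2 u) x y) Hlr (Rlt_le _ _ (Hp2 x y))).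
      assert (Y2 := weighted_young (l * r ^ 2) (eta r x y) (D2 (D1 u) x y) (eta2 r x y)
        (D2 (D2 (D1 u)) x y) (D1 (D1 u) x y) Hlr (Rlt_le _ _ (Hp x y))).
      unfold dirichlet, W, V, p0, q0; rewrite T1, T2.
      revert HD Y1 Y2; clear.
      generalize (D1 (D1 u) x y)
        (D2 (D2 (D1 u)) x y) (D1 (D2 (D1 u)) x y) (D2 (D2 u) x y)
        (D2 (D1 u) x y) (D1 (D1 (D2 (D1 u))) x y) (D2 (D2 (D2 (D1 u))) x y).
      generalize (eta r x y) (eta1 r x y) (eta2 r x y) (4 / (l * r ^ 2)).
      intros n e1 e2 m al s2 s1 be s s11 s22 HD Y1 Y2.
      assert (HD' : n ^ 4 * s * (be * s11 + al * s22 + 2 * s1 * s2) = 0)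
        by (rewrite HD; ring).
      lra. }
  rewrite square_int_plus, Hdiv, square_int_plus, square_int_scal, square_int_scal in Hle;
    auto; try lra.
  2:{ apply cont2_plus; assumption. }
  assert (H4 : 4 / (l * r ^ 2) * square_int r V <= 6400 * (K + 1) ^ 3 / l); [|lra].
  replace (6400 * (K + 1) ^ 3 / l) with
    (4 / (l * r ^ 2) * (1600 * (K + 1) ^ 3 * r ^ 2)) by (field; lra).
  apply Rmult_le_compat_l; [|exact HV].
  apply Rlt_le, Rdiv_lt_0_compat; [lra|].
  apply Rmult_lt_0_compat; [lra | apply pow_lt; lra].
Qed.

Lemma eta_pow_nonneg r x y n : 0 < r -> - r <= x <= r -> - r <= y <= r ->
  0 <= eta r x y ^ n.
Proof. intros; apply pow_le, eta_bounds; assumption. Qed.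

Lemma gradient_weight_cont2 u r : smooth u ->
  cont2 (fun x y => eta r x y ^ 4 *
      (r ^ 2 * eta1 r x y ^ 2 * (D2 (D2 u) x y * D1 (D2 (D1 u)) x y ^ 2) +
       r ^ 2 * eta2 r x y ^ 2 * (D1 (D1 u) x y * D2 (D2 (D1 u)) x y ^ 2))).
Proof. intros Hs; unfold pow; cont2_tac. Qed.

Lemma gradient_weight_le u r x y : solution u -> 0 < r ->
  - r <= x <= r -> - r <= y <= r ->
  r ^ 2 * eta1 r x y ^ 2 * (D2 (D2 u) x y * D1 (D2 (D1 u)) x y ^ 2) +
  r ^ 2 * eta2 r x y ^ 2 * (D1 (D1 u) x y * D2 (D2 (D1 u)) x y ^ 2)
  <= 4 * (x / r) ^ 2 * (D2 (D2 u) x y * D1 (D2 (D1 u)) x y ^ 2)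
   + 4 * (y / r) ^ 2 * (D1 (D1 u) x y * D2 (D2 (D1 u)) x y ^ 2).
Proof.
  intros Hu Hr Hx Hy; assert (H2 := solution_u22_pos u Hu x y).
  assert (H1 := proj1 (proj2 Hu) x y).
  apply Rplus_le_compat; apply Rmult_le_compat_r.
  - apply Rmult_le_pos; [lra | apply pow2_ge_0].
  - apply eta1_sq; assumption.
  - apply Rmult_le_pos; [lra | apply pow2_ge_0].
  - apply eta2_sq; assumption.
Qed.

(** Young's parameter [1 / 8] makes the gradient term at most half of the
    energy, since [r^2 |grad eta|^2] is at most 4 in each direction. *)
Lemma energy_bounded u K r : solution u -> linear_gradient K u -> 1 <= r ->
  energy u r <= 16 * (6400 * (K + 1) ^ 3).
Proof.
  intros Hu HK Hr; assert (Hs := proj1 Hu).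
  assert (H := caccioppoli u K r (1 / 8) Hu HK Hr ltac:(lra)).
  match type of H with _ <= _ * ?w + _ => assert (Hw : w <= 4 * energy u r) end.
  { unfold energy; rewrite <- square_int_scal; [|lra|apply energy_cont2; auto].
    apply square_int_le; [lra| | |].
    - apply gradient_weight_cont2, Hs.
    - apply cont2_mult; [apply cont2_const | apply energy_cont2; auto].
    - intros x y Hx Hy.
      replace (4 * (eta r x y ^ 4 * dirichlet u x y))
        with (eta r x y ^ 4 * (4 * dirichlet u x y)) by ring.
      apply Rmult_le_compat_l; [apply eta_pow_nonneg; lra|].
      eapply Rle_trans; [apply gradient_weight_le; auto; lra|].
      assert (H1 := square_scaled r x ltac:(lra) Hx).
      assert (H2 := square_scaled r y ltac:(lra) Hy).
      assert (P2 := solution_u22_pos u Hu x y).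
      assert (P1 := proj1 (proj2 Hu) x y).
      unfold dirichlet; rewrite Rmult_plus_distr_l.
      apply Rplus_le_compat; apply Rmult_le_compat_r; try lra;
        (apply Rmult_le_pos; [lra | apply pow2_ge_0]). }
  lra.
Qed.

(** The gradient term is controlled by the increase of the energy from [r] to
    [2 r], by [eta_double]; the constant 15 bounds 4 * 32 / 9. *)
Lemma energy_step u K r l : solution u -> linear_gradient K u -> 1 <= r -> 0 < l ->
  energy u r <= energy u (2 * r) /\
  energy u r <= l * 15 * (energy u (2 * r) - energy u r) + 6400 * (K + 1) ^ 3 / l.
Proof.
  intros Hu HK Hr Hl; assert (Hs := proj1 Hu).
  assert (Hlarge : square_int r (fun x y => eta (2 * r) x y ^ 4 * dirichlet u x y)
     <= energy u (2 * r)).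
  { apply square_int_mono; [lra|lra|apply energy_cont2; auto|].
    intros x y Hx Hy; apply Rmult_le_pos; [apply eta_pow_nonneg; lra|].
    apply dirichlet_nonneg, Hu. }
  assert (Hmono : energy u r <= energy u (2 * r)).
  { eapply Rle_trans; [|exact Hlarge].
    apply square_int_le; [lra|apply energy_cont2; auto|apply energy_cont2; auto|].
    intros x y Hx Hy; apply Rmult_le_compat_r; [apply dirichlet_nonneg, Hu|].
    assert (H := eta_double r x y ltac:(lra) Hx Hy).
    assert (H0 := eta_pow_nonneg r x y 4 ltac:(lra) Hx Hy).
    assert (H1 := pow2_ge_0 (x / r)); assert (H2 := pow2_ge_0 (y / r)). nra. }
  split; [exact Hmono|].
  assert (H := caccioppoli u K r l Hu HK Hr Hl).
  match type of H with _ <= _ * ?w + _ =>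
    assert (Hw : w <= 15 * square_int r (fun x y => eta (2 * r) x y ^ 4 * dirichlet u x y
       + -1 * (eta r x y ^ 4 * dirichlet u x y))) end.
  { assert (Hc : cont2 (fun x y => eta (2 * r) x y ^ 4 * dirichlet u x y
       + -1 * (eta r x y ^ 4 * dirichlet u x y))).
    { apply cont2_plus; [apply energy_cont2; auto|].
      apply cont2_mult; [apply cont2_const | apply energy_cont2; auto]. }
    rewrite <- square_int_scal; [|lra|exact Hc].
    apply square_int_le; [lra|apply gradient_weight_cont2, Hs| |].
    - apply cont2_mult; [apply cont2_const | exact Hc].
    - intros x y Hx Hy.
      assert (He := eta_double r x y ltac:(lra) Hx Hy).
      assert (H0 := eta_pow_nonneg r x y 4 ltac:(lra) Hx Hy).
      assert (HE := dirichlet_nonneg u x y Hu).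
      apply Rle_trans with
        (eta r x y ^ 4 * (4 * ((x / r) ^ 2 + (y / r) ^ 2) * dirichlet u x y)).
      + apply Rmult_le_compat_l; [exact H0|].
        eapply Rle_trans; [apply gradient_weight_le; auto; lra|].
        assert (P2 := solution_u22_pos u Hu x y).
        assert (P1 := proj1 (proj2 Hu) x y).
        unfold dirichlet.
        assert (Q1 := Rmult_le_pos _ _ (Rlt_le _ _ P2) (pow2_ge_0 (D1 (D2 (D1 u)) x y))).
        assert (Q2 := Rmult_le_pos _ _ (Rlt_le _ _ P1) (pow2_ge_0 (D2 (D2 (D1 u)) x y))).
        assert (H1 := pow2_ge_0 (x / r)); assert (H2 := pow2_ge_0 (y / r)).
        assert (M1 := Rmult_le_pos _ _ H2 Q1); assert (M2 := Rmult_le_pos _ _ H1 Q2).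
        lra.
      + replace (15 * (eta (2 * r) x y ^ 4 * dirichlet u x y
          + -1 * (eta r x y ^ 4 * dirichlet u x y)))
          with (15 * (eta (2 * r) x y ^ 4 - eta r x y ^ 4) * dirichlet u x y) by ring.
        rewrite <- Rmult_assoc; apply Rmult_le_compat_r; [exact HE|].
        assert (H1 := pow2_ge_0 (x / r)); assert (H2 := pow2_ge_0 (y / r)).
        assert (M := Rmult_le_pos _ _ (Rplus_le_le_0_compat _ _ H1 H2) H0).
        lra. }
  rewrite square_int_plus, square_int_scal in Hw; try lra; try (apply energy_cont2; auto).
  2:{ apply cont2_mult; [apply cont2_const | apply energy_cont2; auto]. }
  fold (energy u r) in Hw.
  assert (l * square_int r (fun x y => eta (2 * r) x y ^ 4 * dirichlet u x y)
      <= l * energy u (2 * r))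
    by (apply Rmult_le_compat_l; lra).
  match type of H with _ <= _ * ?w + _ =>
    assert (l * w <= l * (15 * (energy u (2 * r) - energy u r)))
      by (apply Rmult_le_compat_l; lra) end.
  lra.
Qed.

(** If [e 0 > 0], choosing [l] with [b / l = e 0 / 2] and summing the last
    hypothesis over [n < N] gives [N * e 0 / 2 <= l c (c b)] for every [N]. *)
Lemma hole_filling (e : nat -> R) c b : 0 <= e O -> 0 < b -> 0 < c ->
  (forall n, e n <= c * b) -> (forall n, e n <= e (S n)) ->
  (forall l n, 0 < l -> e n <= l * c * (e (S n) - e n) + b / l) ->
  e O = 0.
Proof.
  intros H0 Hb Hc Hbd Hm Hs.
  destruct H0 as [H0|H0]; [exfalso|auto].
  set (l := 2 * b / e O).
  assert (Hl : 0 < l) by (apply Rdiv_lt_0_compat; lra).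
  assert (Hbl : b / l = e O / 2) by (unfold l; field; lra).
  assert (Hm0 : forall n, e O <= e n).
  { induction n as [|n IH]; [lra | specialize (Hm n); lra]. }
  assert (Hsum : forall n, INR n * (e O / 2) <= l * c * (e n - e O)).
  { induction n as [|n IH]; [simpl; lra|].
    rewrite S_INR; assert (H1 := Hs l n Hl); assert (H2 := Hm0 n); lra. }
  destruct (INR_unbounded (l * c * (c * b) / (e O / 2))) as [n Hn].
  assert (H1 := Hsum n).
  apply Rlt_div_l in Hn; [|lra].
  assert (l * c * (e n - e O) <= l * c * (c * b)); [|lra].
  apply Rmult_le_compat_l; [apply Rmult_le_pos; lra|].
  specialize (Hbd n); lra.
Qed.

Lemma energy_zero u K r : solution u -> linear_gradient K u -> 1 <= r ->
  energy u r = 0.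
Proof.
  intros Hu HK Hr.
  assert (HK0 := linear_gradient_nonneg K u HK).
  assert (HB : 0 < 6400 * (K + 1) ^ 3)
    by (apply Rmult_lt_0_compat; [lra | apply pow_lt; lra]).
  assert (Hrn : forall n, 1 <= 2 ^ n * r).
  { intros n; assert (1 <= 2 ^ n) by (apply pow_R1_Rle; lra). nra. }
  assert (H : energy u (2 ^ 0 * r) = 0).
  { apply (hole_filling (fun n => energy u (2 ^ n * r)) 16 (6400 * (K + 1) ^ 3));
      try lra.
    - apply square_int_nonneg; [simpl; lra|apply energy_cont2; auto; apply Hu|].
      intros x y Hx Hy; apply Rmult_le_pos; [|apply dirichlet_nonneg, Hu].
      apply eta_pow_nonneg; auto; simpl; lra.
    - intros n; apply energy_bounded; auto.
    - intros n; replace (2 ^ S n * r) with (2 * (2 ^ n * r)) by (simpl; ring).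
      apply (energy_step u K _ 1); auto; lra.
    - intros l n Hl; replace (2 ^ S n * r) with (2 * (2 ^ n * r)) by (simpl; ring).
      destruct (energy_step u K (2 ^ n * r) l Hu HK (Hrn n) Hl) as [H1 H2].
      assert (l * 15 * (energy u (2 * (2 ^ n * r)) - energy u (2 ^ n * r))
        <= l * 16 * (energy u (2 * (2 ^ n * r)) - energy u (2 ^ n * r))); [|lra].
      apply Rmult_le_compat_r; lra. }
  replace (2 ^ 0 * r) with r in H by (simpl; ring). exact H.
Qed.

Lemma dirichlet_zero u K : solution u -> linear_gradient K u ->
  forall x y, dirichlet u x y = 0.
Proof.
  intros Hu HK x y.
  set (r := 1 + Rabs x + Rabs y).
  assert (Hx0 := Rabs_pos x); assert (Hy0 := Rabs_pos y).
  assert (Hx : - r < x < r) by (split; unfold r;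
     [assert (H := Rle_abs (- x)); rewrite Rabs_Ropp in H; lra
     | assert (H := Rle_abs x); lra]).
  assert (Hy : - r < y < r) by (split; unfold r;
     [assert (H := Rle_abs (- y)); rewrite Rabs_Ropp in H; lra
     | assert (H := Rle_abs y); lra]).
  assert (Hr : 1 <= r) by (unfold r; lra).
  assert (H := square_int_zero_eq r _ ltac:(lra) (energy_cont2 u r (proj1 Hu))
    (fun x y Hx Hy => Rmult_le_pos _ _ (eta_pow_nonneg r x y 4 ltac:(lra) Hx Hy)
       (dirichlet_nonneg u x y Hu)) (energy_zero u K r Hu HK Hr) x y Hx Hy).
  cbv beta in H; apply Rmult_integral in H; destruct H as [H|H]; [exfalso|exact H].
  revert H; apply pow_nonzero; unfold eta; apply Rmult_integral_contrapositive.
  assert (Hq : forall z, - r < z < r -> 1 - (z / r) ^ 2 <> 0).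
  { intros z Hz.
    assert (-1 < z / r) by (apply Rlt_div_r; lra).
    assert (z / r < 1) by (apply Rlt_div_l; lra). nra. }
  split; apply Hq; assumption.
Qed.

(** * Quadratic polynomials *)

Lemma der_zero_const f : der1 f (fun _ _ => 0) -> der2 f (fun _ _ => 0) ->
  forall x y, f x y = f 0 0.
Proof.
  intros H1 H2 x y.
  assert (Hz : forall (g : R -> R), (forall t, is_derive g t 0) -> forall t, g t = g 0).
  { intros g Hg t.
    destruct (MVT_gen g 0 t (fun _ => 0)) as [c [_ Hc]].
    - intros; apply Hg.
    - intros z _; apply continuity_pt_filterlim.
      apply (ex_derive_continuous (V := R_NormedModule)); eexists; apply Hg.
    - lra. }
  rewrite (Hz (fun t => f t y) (fun t => H1 t y) x).
  apply (Hz (fun t => f 0 t) (fun t => H2 0 t) y).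
Qed.

Lemma third_derivatives_zero u K : solution u -> linear_gradient K u ->
  forall x y, D1 (D1 (D1 u)) x y = 0 /\ D1 (D2 (D1 u)) x y = 0 /\
    D2 (D2 (D1 u)) x y = 0 /\ D2 (D2 (D2 u)) x y = 0.
Proof.
  intros Hu HK x y.
  assert (HE := dirichlet_zero u K Hu HK x y).
  assert (P2 := solution_u22_pos u Hu x y).
  assert (P1 := proj1 (proj2 Hu) x y).
  assert (E1 := D1_equation u Hu x y); assert (E2 := D2_equation u Hu x y).
  unfold dirichlet in HE.
  assert (Q1 := Rmult_le_pos _ _ (Rlt_le _ _ P2) (pow2_ge_0 (D1 (D2 (D1 u)) x y))).
  assert (Q2 := Rmult_le_pos _ _ (Rlt_le _ _ P1) (pow2_ge_0 (D2 (D2 (D1 u)) x y))).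
  assert (Hsq : forall w t, 0 < w -> w * t ^ 2 = 0 -> t = 0).
  { intros w t Hw Ht; apply Rmult_integral in Ht; destruct Ht as [Ht|Ht]; [lra|].
    apply Rsqr_0_uniq; unfold Rsqr; simpl in Ht; lra. }
  assert (S1 : D1 (D2 (D1 u)) x y = 0) by (apply (Hsq _ _ P2); lra).
  assert (S2 : D2 (D2 (D1 u)) x y = 0) by (apply (Hsq _ _ P1); lra).
  rewrite S2, Rmult_0_r, Rplus_0_r in E1; rewrite S1, Rmult_0_l, Rplus_0_l in E2.
  apply Rmult_integral in E1, E2; repeat split; auto.
  - destruct E1; [assumption | lra].
  - destruct E2; [lra | assumption].
Qed.

Lemma constant_hessian_quadratic u a s b : smooth u ->
  (forall x y, D1 (D1 u) x y = a) -> (forall x y, D2 (D1 u) x y = s) ->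
  (forall x y, D2 (D2 u) x y = b) ->
  exists d e f, forall x y,
    u x y = a / 2 * x ^ 2 + s * (x * y) + b / 2 * y ^ 2 + d * x + e * y + f.
Proof.
  intros Hu Ha Hs Hb.
  assert (Hlin1 : forall p q, der1 (fun x y => p * x + q * y) (fun _ _ => p))
    by (intros p q x y; auto_derive; [exact Logic.I | ring]).
  assert (Hlin2 : forall p q, der2 (fun x y => p * x + q * y) (fun _ _ => q))
    by (intros p q x y; auto_derive; [exact Logic.I | ring]).
  assert (Hd : forall x y, D1 u x y = a * x + s * y + D1 u 0 0).
  { intros x y.
    assert (H := der_zero_const (fun x y => D1 u x y + - (a * x + s * y))).
    cbv beta in H; rewrite <- (Rplus_0_r (D1 u 0 0)).
    replace (D1 u 0 0 + 0) with (D1 u 0 0 + - (a * 0 + s * 0)) by ring.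
    rewrite <- (H) with (x := x) (y := y); [ring| |]; clear H; intros p q.
    - replace 0 with (D1 (D1 u) p q + - a) by (rewrite Ha; ring).
      apply (der1_plus _ _ _ _ (smooth_der1 _ (smooth_D1 _ Hu))
               (der1_opp _ _ (Hlin1 a s))).
    - replace 0 with (D2 (D1 u) p q + - s) by (rewrite Hs; ring).
      apply (der2_plus _ _ _ _ (smooth_der2 _ (smooth_D1 _ Hu))
               (der2_opp _ _ (Hlin2 a s))). }
  assert (He : forall x y, D2 u x y = s * x + b * y + D2 u 0 0).
  { intros x y.
    assert (H := der_zero_const (fun x y => D2 u x y + - (s * x + b * y))).
    cbv beta in H; rewrite <- (Rplus_0_r (D2 u 0 0)).
    replace (D2 u 0 0 + 0) with (D2 u 0 0 + - (s * 0 + b * 0)) by ring.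
    rewrite <- (H) with (x := x) (y := y); [ring| |]; clear H; intros p q.
    - replace 0 with (D1 (D2 u) p q + - s) by (rewrite (D1_D2 u Hu), Hs; ring).
      apply (der1_plus _ _ _ _ (smooth_der1 _ (smooth_D2 _ Hu))
               (der1_opp _ _ (Hlin1 s b))).
    - replace 0 with (D2 (D2 u) p q + - b) by (rewrite Hb; ring).
      apply (der2_plus _ _ _ _ (smooth_der2 _ (smooth_D2 _ Hu))
               (der2_opp _ _ (Hlin2 s b))). }
  revert Hd He; generalize (D1 u 0 0) (D2 u 0 0); intros d e Hd He.
  exists d, e, (u 0 0); intros x y.
  set (v := fun x y : R => a / 2 * x ^ 2 + s * (x * y) + b / 2 * y ^ 2 + d * x + e * y).
  assert (Hv1 : der1 v (fun x y => a * x + s * y + d))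
    by (intros p q; unfold v; auto_derive; [exact Logic.I | field]).
  assert (Hv2 : der2 v (fun x y => s * x + b * y + e))
    by (intros p q; unfold v; auto_derive; [exact Logic.I | field]).
  assert (H : u x y + - v x y = u 0 0 + - v 0 0).
  { apply (der_zero_const (fun x y => u x y + - v x y)); intros p q.
    - replace 0 with (D1 u p q + - (a * p + s * q + d)) by (rewrite Hd; ring).
      exact (der1_plus _ _ _ _ (smooth_der1 _ Hu) (der1_opp _ _ Hv1) p q).
    - replace 0 with (D2 u p q + - (s * p + b * q + e)) by (rewrite He; ring).
      exact (der2_plus _ _ _ _ (smooth_der2 _ Hu) (der2_opp _ _ Hv2) p q). }
  unfold v in H; lra.
Qed.

(** * Gradient bound from quadratic growth *)

Lemma convex_growth_derivative f f' C r x : convex_on_R f -> is_derive f x f' ->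
  0 < r -> (forall t, - (2 * r) <= t <= 2 * r -> Rabs (f t) <= C) ->
  - r <= x <= r -> Rabs f' * r <= 2 * C.
Proof.
  intros Hf Hd Hr HC Hx.
  assert (H1 := convex_tangent f x f' r Hf Hd).
  assert (H2 := convex_tangent f x f' (- r) Hf Hd).
  assert (A0 := HC x ltac:(lra)); assert (A1 := HC (x + r) ltac:(lra)).
  assert (A2 := HC (x + - r) ltac:(lra)).
  apply Rabs_le_between in A0, A1, A2.
  unfold Rabs; destruct (Rcase_abs f'); lra.
Qed.

Lemma norm_R2_sq (x y : R) : norm ((x, y) : R * R) ^ 2 = x ^ 2 + y ^ 2.
Proof.
  change (sqrt (Rabs x ^ 2 + Rabs y ^ 2) ^ 2 = x ^ 2 + y ^ 2).
  rewrite !pow2_abs, pow2_sqrt; [reflexivity|].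
  apply Rplus_le_le_0_compat; apply pow2_ge_0.
Qed.

Lemma quadratic_growth_gradient u : smooth u -> coordinate_convex u ->
  quadratic_growth u -> exists K, linear_gradient K u.
Proof.
  (* On the square of radius [2 r] one has |u| <= C (1 + 8 r^2) <= 9 C r^2. *)
  intros Hs (_ & Hx & Hy) (C & HC & Hg); exists (18 * C).
  intros r x y Hr Bx By.
  assert (Hb : forall p q, - (2 * r) <= p <= 2 * r -> - (2 * r) <= q <= 2 * r ->
    Rabs (u p q) <= 9 * C * r ^ 2).
  { intros p q Hp Hq; apply Rlt_le; eapply Rlt_le_trans; [apply Hg|].
    rewrite norm_R2_sq.
    assert (p ^ 2 <= 4 * r ^ 2) by nra. assert (q ^ 2 <= 4 * r ^ 2) by nra.
    assert (1 <= r ^ 2) by nra.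
    apply Rle_trans with (C * (9 * r ^ 2)); [|lra].
    apply Rmult_le_compat_l; lra. }
  split.
  - assert (H := convex_growth_derivative (fun t => u t y) (D1 u x y) (9 * C * r ^ 2) r x
      (Hx y) (smooth_der1 u Hs x y) ltac:(lra) ltac:(intros; apply Hb; lra) Bx).
    apply Rmult_le_reg_r with r; lra.
  - assert (H := convex_growth_derivative (fun t => u x t) (D2 u x y) (9 * C * r ^ 2) r y
      (Hy x) (smooth_der2 u Hs x y) ltac:(lra) ltac:(intros; apply Hb; lra) By).
    apply Rmult_le_reg_r with r; lra.
Qed.

Theorem corollary1p2 (u : R -> R -> R)
  (u_smooth : smooth u)
  (u_convex : coordinate_convex u)
  (u_eq : forall x y : R,
     sqrt (partial_derive 2 0 u x y * partial_derive 0 2 u x y) = 1)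
  (u_growth : quadratic_growth u) :
  quadratic_polynomial u.
Proof.
  assert (Hsol : solution u).
  { assert (Heq : forall x y, D1 (D1 u) x y * D2 (D2 u) x y = 1).
    { intros x y; assert (H := u_eq x y).
      change (sqrt (D1 (D1 u) x y * D2 (D2 u) x y) = 1) in H.
      destruct (Rle_or_lt (D1 (D1 u) x y * D2 (D2 u) x y) 0) as [Hn|Hn].
      - rewrite sqrt_neg_0 in H by exact Hn; lra.
      - rewrite <- (sqrt_sqrt _ (Rlt_le _ _ Hn)), H; ring. }
    split; [exact u_smooth | split; [|exact Heq]].
    intros x y; specialize (Heq x y).
    assert (H := convex_second_derivative (fun t => u t y) (fun t => D1 u t y) x
      (D1 (D1 u) x y) (proj1 (proj2 u_convex) y) (fun t => smooth_der1 u u_smooth t y)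
      (smooth_der1 _ (smooth_D1 u u_smooth) x y)).
    destruct H as [H|H]; [exact H | rewrite <- H in Heq; lra]. }
  destruct (quadratic_growth_gradient u u_smooth u_convex u_growth) as [K HK].
  assert (H3 := third_derivatives_zero u K Hsol HK).
  assert (Hconst : forall f, smooth f -> (forall x y, D1 f x y = 0) ->
    (forall x y, D2 f x y = 0) -> forall x y, f x y = f 0 0).
  { intros f Hf Z1 Z2; apply der_zero_const; intros p q.
    - rewrite <- (Z1 p q); apply smooth_der1, Hf.
    - rewrite <- (Z2 p q); apply smooth_der2, Hf. }
  destruct (constant_hessian_quadratic u (D1 (D1 u) 0 0) (D2 (D1 u) 0 0) (D2 (D2 u) 0 0)
    u_smooth) as (d & e & f & H).
  - apply (Hconst (D1 (D1 u))); [smooth_tac| |]; intros x y.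
    + exact (proj1 (H3 x y)).
    + rewrite (D2_u11 u u_smooth); exact (proj1 (proj2 (H3 x y))).
  - apply (Hconst (D2 (D1 u))); [smooth_tac| |]; intros x y.
    + exact (proj1 (proj2 (H3 x y))).
    + exact (proj1 (proj2 (proj2 (H3 x y)))).
  - apply (Hconst (D2 (D2 u))); [smooth_tac| |]; intros x y.
    + rewrite (D1_u22 u u_smooth); exact (proj1 (proj2 (proj2 (H3 x y)))).
    + exact (proj2 (proj2 (proj2 (H3 x y)))).
  - exists (D1 (D1 u) 0 0 / 2), (D2 (D1 u) 0 0), (D2 (D2 u) 0 0 / 2), d, e, f.
    split; [left | exact H].
    assert (Hp := proj1 (proj2 Hsol) 0 0); lra.
Qed.
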